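(* Let $\mathcal{D}\subset\mathbb{R}^n$ be a compact convex set with set of extreme points $\mathcal{V}$ (so $\mathcal{D}=\operatorname{conv}(\mathcal{V})$), and let $f:\mathbb{R}^n\to\mathbb{R}$ be convex and differentiable, not constant on $\mathcal{D}$, with minimizer $x^*$ over $\mathcal{D}$. Let $C_f^A$ be the (two-sided) curvature constant of $f$ over $\mathcal{D}$, assumed to satisfy $0<C_f^A<\infty$, and let $\mu_f^A$ be the geometric strong convexity constant of $f$ over $\mathcal{D}$ (both defined in the context). Let $(x^{(k)})_{k\ge0}$ be the iterates of the Frank-Wolfe algorithm with away steps (see context), run either with line-search or with step-sizes $\gamma_k:=\min\{1,\gamma_{\max},\gamma_k^B\}$, where $\gamma_k^B:=\frac{g_k}{2C_f^A}$ and $g_k:=\langle-\nabla f(x^{(k)}),s_k-v_k\rangle$. Let $h_k:=f(x^{(k)})-f(x^* )$ and $\rho_f^A:=\frac{\mu_f^A}{4C_f^A}$. Then: (i) at each step $k$ that is not a drop step, $h_{k+1}\le(1-\rho_f^A)\,h_k$; (ii) the number of drop steps up to iteration $k$ is at most $k/2$; (iii) consequently, $h_k\le h_0\exp\left(-\tfrac12\rho_f^A k\right)$ for all $k\ge0$.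
   Context: Two-sided curvature constant: $$C_f^A:=\sup\left\{\tfrac{2}{\gamma^2}\big(f(y)-f(x)-\langle\nabla f(x),y-x\rangle\big)\ :\ x,s\in\mathcal{D},\ \gamma\in[-1,1]\setminus\{0\},\ y=x+\gamma(s-x)\right\}.$$ Geometric strong convexity constant. For $x\in\mathcal{D}$ let $s_f(x)\in\arg\min_{v\in\mathcal{V}}\langle\nabla f(x),v\rangle$. Let $\mathcal{S}_x$ be the collection of all (finite) sets $S\subseteq\mathcal{V}$ such that $x$ is a convex combination of all the elements of $S$ with all coefficients non-zero. For $S\in\mathcal{S}_x$ let $v_S(x)\in\arg\max_{v\in S}\langle\nabla f(x),v\rangle$, and let $v_f(x)\in\arg\min\{\langle\nabla f(x),v\rangle : v=v_S(x),\ S\in\mathcal{S}_x\}$ (only the value $\langle\nabla f(x),v_f(x)\rangle=\inf_{S\in\mathcal{S}_x}\max_{v\in S}\langle\nabla f(x),v\rangle$ matters; it is read as this infimum if it is not attained). Define $$\mu_f^A:=\inf_{x\in\mathcal{D}}\ \inf_{\substack{z\in\mathcal{D}\\ \langle\nabla f(x),z-x\rangle<0}}\ \frac{2}{\gamma^A(x,z)^2}\big(f(z)-f(x)-\langle\nabla f(x),z-x\rangle\big),\qquad \gamma^A(x,z):=\frac{\langle\nabla f(x),z-x\rangle}{\langle\nabla f(x),s_f(x)-v_f(x)\rangle}.$$ Frank-Wolfe algorithm with away steps. The iterate is maintained as $x^{(k)}=\sum_{v\in S^{(k)}}\alpha_v^{(k)}v$, a convex combination with weights $\alpha^{(k)}_v>0$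 for $v$ in the active set $S^{(k)}\subseteq\mathcal{V}$, and $\alpha^{(k)}_v=0$ otherwise. Start with $x^{(0)}\in\mathcal{V}$, $S^{(0)}=\{x^{(0)}\}$, $\alpha^{(0)}_{x^{(0)}}=1$. At iteration $k$: - Choose $s_k\in\arg\min_{v\in\mathcal{V}}\langle\nabla f(x^{(k)}),v\rangle$ and set $d_k^{FW}:=s_k-x^{(k)}$. Choose $v_k\in\arg\max_{v\in S^{(k)}}\langle\nabla f(x^{(k)}),v\rangle$ and set $d_k^{A}:=x^{(k)}-v_k$. - If $\langle\nabla f(x^{(k)}),d_k^{FW}\rangle\le\langle\nabla f(x^{(k)}),d_k^A\rangle$, set $d_k:=d_k^{FW}$ and $\gamma_{\max}:=1$ (FW step); otherwise set $d_k:=d_k^A$ and $\gamma_{\max}:=\alpha^{(k)}_{v_k}/(1-\alpha^{(k)}_{v_k})$ (away step). - Choose a step-size $\gamma_k\in[0,\gamma_{\max}]$ and set $x^{(k+1)}:=x^{(k)}+\gamma_kd_k$. Line-search means $\gamma_k\in\arg\min_{\gamma\in[0,\gamma_{\max}]}f(x^{(k)}+\gamma d_k)$. - Weights: for a FW step, $\alpha^{(k+1)}_{s_k}:=(1-\gamma_k)\alpha^{(k)}_{s_k}+\gamma_k$ and $\alpha_v^{(k+1)}:=(1-\gamma_k)\alpha_v^{(k)}$ for $v\in S^{(k)}\setminus\{s_k\}$. For an away step, $\alpha^{(k+1)}_{v_k}:=(1+\gamma_k)\alpha^{(k)}_{v_k}-\gamma_k$ and $\alpha_v^{(k+1)}:=(1+\gamma_k)\alpha_v^{(k)}$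 for $v\in S^{(k)}\setminus\{v_k\}$. Set $S^{(k+1)}:=\{v:\alpha^{(k+1)}_v>0\}$. A drop step is an away step with $\gamma_k=\gamma_{\max}$ (it removes $v_k$ from the active set). *)

(* Defs.v *)
From mathcomp Require Import all_boot all_order all_algebra.
From mathcomp Require Import all_classical all_reals all_analysis.

Set Implicit Arguments.
Unset Strict Implicit.
Unset Printing Implicit Defensive.

Import Order.TTheory GRing.Theory Num.Theory.
Import numFieldNormedType.Exports.

Local Open Scope classical_set_scope.
Local Open Scope ring_scope.

Definition argmin (T : Type) (R : realType) (A : set T) (phi : T -> R) : set T :=
  [set v | A v /\ forall u, A u -> phi v <= phi u].

Definition argmax (T : Type) (R : realType) (A : set T) (phi : T -> R) : set T :=
  [set v | A v /\ forall u, A u -> phi u <= phi v].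

Definition dotp (R : realType) (n : nat) (u v : 'rV[R]_n) : R :=
  \sum_(i < n) u 0 i * v 0 i.

Definition grad (R : realType) (n : nat) (f : 'rV[R]_n -> R) (x : 'rV[R]_n) :
    'rV[R]_n :=
  \row_(i < n) 'D_(delta_mx 0 i) f x.

Definition extreme_points (R : realType) (n : nat) (D : set 'rV[R]_n) :
    set 'rV[R]_n :=
  [set v | D v /\ forall (x y : 'rV[R]_n) (t : R), D x -> D y -> 0 < t < 1 ->
                    v = t *: x + (1 - t) *: y -> x = y].

Definition lin_gap (R : realType) (n : nat) (f : 'rV[R]_n -> R)
    (x y : 'rV[R]_n) : R :=
  f y - f x - dotp (grad f x) (y - x).

(* The point y may lie outside D when g < 0. *)
Definition curvatureA (R : realType) (n : nat) (D : set 'rV[R]_n)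
    (f : 'rV[R]_n -> R) : \bar R :=
  ereal_sup [set c | exists (x s : 'rV[R]_n) (g : R),
    [/\ D x, D s, -1 <= g <= 1, g != 0 &
        let y := x + g *: (s - x) in c = (2 / g ^+ 2 * lin_gap f x y)%:E]].

(* s_f(x); the choice among minimizers does not affect <grad f x, s_f(x)>. *)
Definition s_f (R : realType) (n : nat) (D : set 'rV[R]_n)
    (f : 'rV[R]_n -> R) (x : 'rV[R]_n) : 'rV[R]_n :=
  xget 0 (argmin (extreme_points D) (dotp (grad f x))).

(* The collection S_x of finite sets of which x is a proper convex
   combination (all weights nonzero, hence positive). *)
Definition proper_supports (R : realType) (n : nat) (D : set 'rV[R]_n)
    (x : 'rV[R]_n) : set (set 'rV[R]_n) :=
  [set S | [/\ finite_set S, S `<=` extreme_points D &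
     exists a : 'rV[R]_n -> R,
       [/\ forall v, S v -> 0 < a v,
           \sum_(v \in S) a v = 1 &
           \sum_(v \in S) a v *: v = x]]].

(* The number <grad f x, v_f(x)>, read as the infimum over S in S_x of
   <grad f x, v_S(x)>; for x in a compact convex D this set of reals is
   nonempty and bounded below by <grad f x, x>, so the real inf is genuine. *)
Definition v_f_val (R : realType) (n : nat) (D : set 'rV[R]_n)
    (f : 'rV[R]_n -> R) (x : 'rV[R]_n) : R :=
  inf [set r | exists (S : set 'rV[R]_n) (v : 'rV[R]_n),
    [/\ proper_supports D x S, argmax S (dotp (grad f x)) v &
        r = dotp (grad f x) v]].

(* The denominator is <grad f x, s_f(x) - v_f(x)>. *)
Definition gammaA (R : realType) (n : nat) (D : set 'rV[R]_n)
    (f : 'rV[R]_n -> R) (x z : 'rV[R]_n) : R :=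
  dotp (grad f x) (z - x) / (dotp (grad f x) (s_f D f x) - v_f_val D f x).

Definition strong_convexityA (R : realType) (n : nat) (D : set 'rV[R]_n)
    (f : 'rV[R]_n -> R) : \bar R :=
  ereal_inf [set ereal_inf
      [set (2 / gammaA D f x z ^+ 2 * lin_gap f x z)%:E |
         z in [set z | D z /\ dotp (grad f x) (z - x) < 0]] |
    x in D].

(* [fine] is harmless: for f convex, differentiable and nonconstant on D,
   strong_convexityA D f is the infimum of a nonempty set of nonnegative
   reals. *)
Definition rhoA (R : realType) (n : nat) (D : set 'rV[R]_n)
    (f : 'rV[R]_n -> R) : R :=
  fine (strong_convexityA D f) / (4 * fine (curvatureA D f)).

(* The data x^(k), alpha^(k), s_k, v_k, gamma_k of a run. *)
Record afw_trace (R : realType) (n : nat) := AFWTrace {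
  iterate : nat -> 'rV[R]_n;
  weight : nat -> 'rV[R]_n -> R;
  fw_atom : nat -> 'rV[R]_n;
  away_atom : nat -> 'rV[R]_n;
  stepsize : nat -> R
}.

Definition active_set (R : realType) (n : nat) (tr : afw_trace R n) (k : nat) :
    set 'rV[R]_n :=
  [set v | 0 < weight tr k v].

Definition fw_dir (R : realType) (n : nat) (tr : afw_trace R n) (k : nat) :
    'rV[R]_n :=
  fw_atom tr k - iterate tr k.

Definition away_dir (R : realType) (n : nat) (tr : afw_trace R n) (k : nat) :
    'rV[R]_n :=
  iterate tr k - away_atom tr k.

Definition is_fw_step (R : realType) (n : nat) (f : 'rV[R]_n -> R)
    (tr : afw_trace R n) (k : nat) : bool :=
  dotp (grad f (iterate tr k)) (fw_dir tr k)
    <= dotp (grad f (iterate tr k)) (away_dir tr k).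

Definition step_dir (R : realType) (n : nat) (f : 'rV[R]_n -> R)
    (tr : afw_trace R n) (k : nat) : 'rV[R]_n :=
  if is_fw_step f tr k then fw_dir tr k else away_dir tr k.

(* If the weight of v_k is 1 then x^(k) = v_k and the step is a FW step, so
   the away branch never divides by zero. *)
Definition gamma_max (R : realType) (n : nat) (f : 'rV[R]_n -> R)
    (tr : afw_trace R n) (k : nat) : R :=
  if is_fw_step f tr k then 1
  else weight tr k (away_atom tr k) / (1 - weight tr k (away_atom tr k)).

(* Weights vanish off the active set, so these formulas, used at every u,
   also give weight 0 to the points that are neither active nor s_k. *)
Definition next_weight (R : realType) (n : nat) (f : 'rV[R]_n -> R)
    (tr : afw_trace R n) (k : nat) (u : 'rV[R]_n) : R :=
  let g := stepsize tr k in
  if is_fw_step f tr k then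
    if u == fw_atom tr k then (1 - g) * weight tr k u + g
    else (1 - g) * weight tr k u
  else
    if u == away_atom tr k then (1 + g) * weight tr k u - g
    else (1 + g) * weight tr k u.

(* The representation x^(k) = \sum_v alpha_v v over the active set is a
   consequence of the initialization and of the updates. *)
Record is_afw_run (R : realType) (n : nat) (D : set 'rV[R]_n)
    (f : 'rV[R]_n -> R) (tr : afw_trace R n) : Prop := IsAFWRun {
  afw_init : extreme_points D (iterate tr 0);
  afw_init_weight : forall v, weight tr 0 v = (v == iterate tr 0)%:R;
  afw_fw_atom : forall k,
    argmin (extreme_points D) (dotp (grad f (iterate tr k))) (fw_atom tr k);
  afw_away_atom : forall k,
    argmax (active_set tr k) (dotp (grad f (iterate tr k))) (away_atom tr k);
  afw_stepsize : forall k, 0 <= stepsize tr k <= gamma_max f tr k;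
  afw_iterate : forall k,
    iterate tr k.+1 = iterate tr k + stepsize tr k *: step_dir f tr k;
  afw_weight : forall k v, weight tr k.+1 v = next_weight f tr k v
}.

Definition line_search (R : realType) (n : nat) (f : 'rV[R]_n -> R)
    (tr : afw_trace R n) : Prop :=
  forall k, argmin [set g | 0 <= g <= gamma_max f tr k]
                   (fun g => f (iterate tr k + g *: step_dir f tr k))
                   (stepsize tr k).

Definition afw_gap (R : realType) (n : nat) (f : 'rV[R]_n -> R)
    (tr : afw_trace R n) (k : nat) : R :=
  dotp (- grad f (iterate tr k)) (fw_atom tr k - away_atom tr k).

Definition gammaB (R : realType) (n : nat) (D : set 'rV[R]_n)
    (f : 'rV[R]_n -> R) (tr : afw_trace R n) (k : nat) : R :=
  afw_gap f tr k / (2 * fine (curvatureA D f)).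

Definition curvature_steps (R : realType) (n : nat) (D : set 'rV[R]_n)
    (f : 'rV[R]_n -> R) (tr : afw_trace R n) : Prop :=
  forall k, stepsize tr k =
    Num.min 1 (Num.min (gamma_max f tr k) (gammaB D f tr k)).

Definition is_drop_step (R : realType) (n : nat) (f : 'rV[R]_n -> R)
    (tr : afw_trace R n) (k : nat) : bool :=
  ~~ is_fw_step f tr k && (stepsize tr k == gamma_max f tr k).

(* Drop steps among the k iterations 0, ..., k-1 that lead to x^(k). *)
Definition num_drops (R : realType) (n : nat) (f : 'rV[R]_n -> R)
    (tr : afw_trace R n) (k : nat) : nat :=
  (\sum_(i < k) is_drop_step f tr i)%N.

(* Main.v *)
Require Import Defs.
From mathcomp Require Import all_boot all_order all_algebra.
From mathcomp Require Import all_classical all_reals all_analysis.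
From mathcomp Require Import ring lra zify.
Import Order.TTheory GRing.Theory Num.Theory.
Import numFieldNormedType.Exports.

Local Open Scope classical_set_scope.
Local Open Scope ring_scope.

Set Implicit Arguments.
Unset Strict Implicit.
Unset Printing Implicit Defensive.

(** Write p for the slope <- grad f x, d> along the chosen direction d, g for
the pairwise gap <- grad f x, s - v>, h for the suboptimality, C and mu for
the two constants. The proof is a comparison of progress with suboptimality.

Progress. The gap g is the sum of the slopes along the Frank-Wolfe and the away
directions, so the better of the two has p >= g / 2; moreover p is at least
the Frank-Wolfe slope, hence p >= h. Because the curvature constant is
two-sided, both directions obey f (x + t d) <= f x - t p + C t^2 / 2 for
t in [0, 1], even where x + t d leaves D (curvature_descent). A step that is
not a drop step does at least as well as t = min (1, g / 2C)
(non_drop_progress). For the prescribed step sizes it is that step; for line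
search on an away step, stopping short of the maximal step means that the
minimizer found is a minimizer on the whole ray, by convexity of f on the
whole space.

Suboptimality. The definition of mu at (x, xstar), together with
v_f_val <= <grad f x, v> (the active set is one of the competing supports),
gives mu h <= g^2 / 2 (mu_suboptimality_le). If the step t is g / 2C, the
progress g^2 / 8C is at least (mu / 4C) h. If t = 1, the progress is at least
p / 2 >= h / 2, and one needs mu / 4C <= 1 / 2. This follows from mu <= C
(mu_le_curvature), which is seen at the starting vertex: a vertex is
represented by itself alone, so v_f is the vertex itself, gammaA = 1 for z the
Frank-Wolfe atom, and the quantity bounded below by mu is then the one bounded
above by C. If the starting vertex is already optimal, monotonicity makes every
h vanish and there is nothing to prove.

Drop steps. The active set has one element at the start, is never empty, grows
by at most one in a Frank-Wolfe step, never grows in an away step and shrinks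
in a drop step; so there are at most as many drop steps as Frank-Wolfe steps
(num_drops_le_half). Since h never increases, the rate follows from
1 - rho <= exp (- rho) at the remaining steps.

That D is the convex hull of its extreme points enters only through the fact
that a linear form attains its minimum over D at an extreme point
(linear_min_at_extreme_point). *)

(** * The scalar product *)

Section dot_product.
Variables (R : realType) (n : nat).
Implicit Types (u v w x y : 'rV[R]_n) (a t : R).

Lemma dotpC u v : dotp u v = dotp v u.
Proof. by apply: eq_bigr => i _; rewrite mulrC. Qed.

Lemma dotpDr u v w : dotp u (v + w) = dotp u v + dotp u w.
Proof.
by rewrite -big_split /=; apply: eq_bigr => i _; rewrite mxE mulrDr.
Qed.

Lemma dotpZr u a v : dotp u (a *: v) = a * dotp u v.
Proof.
by rewrite mulr_sumr; apply: eq_bigr => i _; rewrite mxE mulrCA.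
Qed.

Lemma dotpNr u v : dotp u (- v) = - dotp u v.
Proof. by rewrite -scaleN1r dotpZr mulN1r. Qed.

Lemma dotpBr u v w : dotp u (v - w) = dotp u v - dotp u w.
Proof. by rewrite dotpDr dotpNr. Qed.

Lemma dotpNl u v : dotp (- u) v = - dotp u v.
Proof. by rewrite dotpC dotpNr dotpC. Qed.

Lemma dotp0r u : dotp u 0 = 0.
Proof. by rewrite -(scale0r 0) dotpZr mul0r. Qed.

Lemma dotp_sumr (I : Type) (r : seq I) u (F : I -> 'rV[R]_n) :
  dotp u (\sum_(i <- r) F i) = \sum_(i <- r) dotp u (F i).
Proof.
elim: r => [|i r IH]; first by rewrite !big_nil dotp0r.
by rewrite !big_cons dotpDr IH.
Qed.

Lemma dotp_self_ge0 u : 0 <= dotp u u.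
Proof. by apply: sumr_ge0 => i _; rewrite -expr2 sqr_ge0. Qed.

Lemma dotp_self_eq0 u : dotp u u = 0 -> u = 0.
Proof.
move=> /eqP; rewrite psumr_eq0; last by move=> i _; rewrite -expr2 sqr_ge0.
move=> /allP u0; apply/rowP => i; rewrite mxE.
by have := u0 i (mem_index_enum i); rewrite /= mulf_eq0 orbb => /eqP.
Qed.

Lemma continuous_dotp (F G : 'rV[R]_n -> 'rV[R]_n) :
  continuous F -> continuous G -> continuous (fun x => dotp (F x) (G x)).
Proof.
move=> cF cG.
have cc (H : 'rV[R]_n -> 'rV[R]_n) i :
    continuous H -> continuous (fun x => H x 0 i).
  move=> cH x; have := continuous_comp (cH x) (@coord_continuous _ _ _ 0 i _).
  exact.
rewrite /dotp; elim: (index_enum _) => [|i r IH].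
  by under eq_fun do rewrite big_nil; exact: cst_continuous.
under eq_fun do rewrite big_cons.
move=> x; apply: (@continuousD _ _ _ _ _ x); last exact: IH.
by apply: continuousM; exact: cc.
Qed.

(** The strict convexity of the squared Euclidean norm, as an identity. *)
Lemma dotp_conv_self x y t :
  dotp (t *: x + (1 - t) *: y) (t *: x + (1 - t) *: y) =
  t * dotp x x + (1 - t) * dotp y y - t * (1 - t) * dotp (x - y) (x - y).
Proof.
rewrite !(dotpDr, dotpBr, dotpZr, dotpNr).
rewrite ![dotp (_ - _) _]dotpC ![dotp (_ + _) _]dotpC.
by rewrite !(dotpDr, dotpBr, dotpZr, dotpNr) (dotpC y x); ring.
Qed.

End dot_product.

(** * Convexity and the gradient inequality *)

Section convexity.
Variables (R : realType) (n : nat).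
Implicit Types (D : set 'rV[R]_n) (f : 'rV[R]_n -> R) (x y v d : 'rV[R]_n).

Lemma convex_set_segment D x y (t : R) : convex_set D -> D x -> D y ->
  0 <= t <= 1 -> D (t *: x + (1 - t) *: y).
Proof.
move=> cD Dx Dy t01.
have := cD x y (Itv01 (proj1 (andP t01)) (proj2 (andP t01))).
by rewrite !inE; apply.
Qed.

Lemma convex_function_segment f x y (t : R) :
  convex_function [set: 'rV[R]_n] f -> 0 <= t <= 1 ->
  f (t *: x + (1 - t) *: y) <= t * f x + (1 - t) * f y.
Proof.
move=> cf t01.
have := cf (Itv01 (proj1 (andP t01)) (proj2 (andP t01))) x y.
by rewrite !inE; apply.
Qed.

Lemma derive_grad f x v : differentiable f x -> 'D_v f x = dotp (grad f x) v.
Proof.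
move=> df; rewrite deriveE // {1}(row_sum_delta v) linear_sum.
apply: eq_bigr => i _; rewrite linearZ /= mxE deriveE //.
by rewrite mulrC.
Qed.

(** The difference quotients of f at x in the direction y - x are at most
f y - f x for steps in ]0, 1], and so is their limit, the directional
derivative. *)
Lemma lin_gap_ge0 f x y : convex_function [set: 'rV[R]_n] f ->
  differentiable f x -> 0 <= lin_gap f x y.
Proof.
move=> cf df; rewrite /lin_gap subr_ge0 -derive_grad //.
have dv : derivable f x (y - x) by exact: diff_derivable.
rewrite /derive (cvg_at_rightE _ _ dv).
apply: limr_le.
  exact: cvgP (cvg_dnbhs_at_right dv).
near=> t.
have t0 : 0 < t by near: t; exact: nbhs_right_gt.
have t1 : t <= 1 by near: t; apply: nbhs_right_le.
rewrite /= /GRing.scale /= mulrC ler_pdivrMr //.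
have -> : t *: (y - x) + x = t *: y + (1 - t) *: x.
  by rewrite scalerBr scalerBl scale1r; rewrite -!addrA (addrC x).
have := convex_function_segment y x cf (t := t).
rewrite (ltW t0) t1 => /(_ isT); lra.
Unshelve. all: by end_near. Qed.

(** A minimizer over a segment that is not the far end of the segment minimizes
over the whole ray: if a point beyond the segment did better, convexity would
make the far end of the segment better too. *)
Lemma convex_ray_min f y d (a b t : R) :
  convex_function [set: 'rV[R]_n] f -> 0 <= a < b -> 0 <= t ->
  (forall r, 0 <= r <= b -> f (y + a *: d) <= f (y + r *: d)) ->
  f (y + a *: d) <= f (y + t *: d).
Proof.
move=> f_convex /andP[a0 ab] t0 mina.
have [tb|bt] := leP t b; first by rewrite mina ?t0.
have at0 : 0 < t - a by lra.
(* the weight for which b is the convex combination of a and t *)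
pose l := (t - b) / (t - a).
have l01 : 0 <= l <= 1.
  by apply/andP; split; [apply: divr_ge0; lra|rewrite ler_pdivrMr //; lra].
have := convex_function_segment (y + a *: d) (y + t *: d) f_convex l01.
have -> : l *: (y + a *: d) + (1 - l) *: (y + t *: d) = y + b *: d.
  rewrite !scalerDr addrACA -scalerDl !scalerA -scalerDl.
  rewrite addrCA subrr addr0 scale1r.
  by congr (_ + _ *: _); rewrite /l; field; rewrite gt_eqF.
have l1 : 0 < 1 - l.
  suff : l < 1 by lra.
  by rewrite ltr_pdivrMr // mul1r; lra.
have := mina b; rewrite lexx andbT => /(_ _)/le_trans/[apply].
have b0 : 0 <= b by lra.
rewrite b0 => /(_ isT) le; rewrite -(ler_pM2l l1); lra.
Qed.

End convexity.

(** * Linear forms and extreme points *)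

Section extreme_points.
Variables (R : realType) (n : nat) (D : set 'rV[R]_n).
Implicit Types (c s x y z : 'rV[R]_n).

(** On the face of D where the linear form is minimal, take a point p of
largest Euclidean norm. A segment of D with p in its interior stays in the
face, and its end points have norm at most that of p, so by strict convexity
of the squared norm they coincide. *)
Lemma linear_min_at_extreme_point c : compact D -> D !=set0 ->
  exists2 s, extreme_points D s & forall z, D z -> dotp c s <= dotp c z.
Proof.
move=> cD D0.
have cc : continuous (dotp c).
  by apply: continuous_dotp => x; [exact: cst_continuous|exact: cvg_id].
have [m] := EVT_min_rV D0 cD (continuous_subspaceT cc).
rewrite inE => Dm minm.
have {}minm z : D z -> dotp c m <= dotp c z.
  by move=> Dz; apply: minm; rewrite inE.
pose F := D `&` [set x | dotp c x = dotp c m].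
have cF : compact F.
  apply: compact_closedI => //.
  have /continuous_closedP/(_ _ (@closed_eq _ (dotp c m))) := cc.
  exact.
have cn : continuous (fun x : 'rV[R]_n => dotp x x).
  by apply: continuous_dotp => x; exact: cvg_id.
have F0 : F !=set0 by exists m; split.
have [p] := EVT_max_rV F0 cF (continuous_subspaceT cn).
rewrite inE => -[Dp cp] maxp; exists p; last by move=> z Dz; rewrite cp minm.
split=> // x y t Dx Dy /andP[t0 t1] pE.
have cx := minm x Dx; have cy := minm y Dy.
have cE : dotp c m = t * dotp c x + (1 - t) * dotp c y.
  by rewrite -cp pE dotpDr !dotpZr.
have Fx : dotp c x = dotp c m by nra.
have Fy : dotp c y = dotp c m by nra.
have nx : dotp x x <= dotp p p by apply: maxp; rewrite inE.
have ny : dotp y y <= dotp p p by apply: maxp; rewrite inE.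
have := dotp_conv_self x y t; rewrite -pE => pp.
have := dotp_self_ge0 (x - y) => xy0.
apply/eqP; rewrite -subr_eq0; apply/eqP/dotp_self_eq0.
have t01 : 0 < t * (1 - t) by nra.
apply/eqP; rewrite eq_le xy0 andbT -(pmulr_rle0 _ t01); nra.
Qed.

Lemma argmin_extreme_points c s z : compact D ->
  argmin (extreme_points D) (dotp c) s -> D z -> dotp c s <= dotp c z.
Proof.
move=> cD [es mins] Dz.
have [s' es' mins'] := linear_min_at_extreme_point c cD (ex_intro _ z Dz).
exact: le_trans (mins _ es') (mins' _ Dz).
Qed.

End extreme_points.

(** * Convex combinations of finitely many points *)

Section convex_combinations.
Variables (R : realType) (n : nat).
Implicit Types (D S : set 'rV[R]_n) (L : seq 'rV[R]_n) (a : 'rV[R]_n -> R).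
Implicit Types (c v x : 'rV[R]_n).

Lemma convex_set_sum D L a : convex_set D -> (forall v, v \in L -> D v) ->
  (forall v, v \in L -> 0 <= a v) -> \sum_(v <- L) a v = 1 ->
  D (\sum_(v <- L) a v *: v).
Proof.
move=> cD DL a0 a1.
(* normalized form, for the induction: the weights of the tail of L need not
   sum to 1 *)
suff {a1} : 0 < \sum_(v <- L) a v ->
    D ((\sum_(v <- L) a v)^-1 *: \sum_(v <- L) a v *: v).
  by rewrite a1 invr1 scale1r; apply.
elim: L DL a0 => [|v L IH] DL a0; first by rewrite big_nil ltxx.
rewrite !big_cons; set t := \sum_(u <- L) a u => vt0.
have Dv : D v by apply: DL; rewrite mem_head.
have av0 : 0 <= a v by apply: a0; rewrite mem_head.
have DL' u : u \in L -> D u by move=> uL; apply: DL; rewrite inE uL orbT.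
have aL0 u : u \in L -> 0 <= a u by move=> uL; apply: a0; rewrite inE uL orbT.
have t0 : 0 <= t by rewrite /t big_seq sumr_ge0.
have [tz|tn] := eqVneq t 0.
  have -> : \sum_(u <- L) a u *: u = 0.
    rewrite big_seq big1 // => u uL; suff -> : a u = 0 by rewrite scale0r.
    move: tz; rewrite /t big_seq => /eqP.
    rewrite psumr_eq0 // => /allP/(_ u uL).
    by rewrite uL => /eqP.
  move: vt0; rewrite tz !addr0 => vt0.
  by rewrite scalerA mulVf ?gt_eqF // scale1r.
have {}t0 : 0 < t by rewrite lt_neqAle eq_sym tn.
have := IH DL' aL0 t0.
have := convex_set_segment (t := a v / (a v + t)) cD Dv.
move=> /[apply].
have -> : 0 <= a v / (a v + t) <= 1.
  by rewrite divr_ge0 ?(ltW vt0) //= ler_pdivrMr // mul1r lerDl ltW.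
move=> /(_ isT); congr D.
rewrite scalerDr !scalerA; congr (_ *: _ + _ *: _); first by rewrite mulrC.
by rewrite -/t; field; rewrite !gt_eqF.
Qed.

Lemma dotp_convex_sum_le c L a M : (forall v, v \in L -> 0 <= a v) ->
  \sum_(v <- L) a v = 1 -> (forall v, v \in L -> dotp c v <= M) ->
  dotp c (\sum_(v <- L) a v *: v) <= M.
Proof.
move=> a0 a1 vM; rewrite dotp_sumr -[M]mul1r -a1 mulr_suml.
rewrite big_seq [leRHS]big_seq; apply: ler_sum => v vL.
by rewrite dotpZr ler_wpM2l ?a0 ?vM.
Qed.

Lemma proper_supports_seq D L a : uniq L ->
  (forall v, v \in L -> extreme_points D v) -> (forall v, v \in L -> 0 < a v) ->
  \sum_(v <- L) a v = 1 ->
  proper_supports D (\sum_(v <- L) a v *: v) [set` L].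
Proof.
move=> uL eL a0 a1; split; [exact: finite_seq|by []|exists a].
by split; rewrite -?fsbig_seq.
Qed.

(** An average is at most the maximum. This is why the infimum that defines
v_f_val is over a set bounded below. *)
Lemma proper_supports_max_ge D S c x v :
  proper_supports D x S -> argmax S (dotp c) v -> dotp c x <= dotp c v.
Proof.
move=> [fS _ [a [a0 a1 ax]]] [_ maxv].
have [L0 SL0] := (finite_seqP S).1 fS.
have SL : S = [set` undup L0].
  by rewrite SL0; apply/seteqP; split=> u /=; rewrite mem_undup.
rewrite -ax SL -fsbig_seq ?undup_uniq //.
apply: dotp_convex_sum_le => [u uL|| u uL].
- by apply/ltW/a0; rewrite SL.
- by move: a1; rewrite SL -fsbig_seq ?undup_uniq.
- by apply: maxv; rewrite SL.
Qed.

End convex_combinations.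

(** * The curvature and the geometric strong convexity constants *)

Section constants.
Variables (R : realType) (n : nat) (D : set 'rV[R]_n) (f : 'rV[R]_n -> R).
Implicit Types (x z s v : 'rV[R]_n) (S : set 'rV[R]_n).

Lemma lin_gap_curvature x s (g : R) :
  (0 < curvatureA D f)%E -> (curvatureA D f < +oo)%E ->
  D x -> D s -> -1 <= g <= 1 ->
  lin_gap f x (x + g *: (s - x)) <= fine (curvatureA D f) / 2 * g ^+ 2.
Proof.
move=> C0 Coo Dx Ds g1; have [->|g0] := eqVneq g 0.
  by rewrite scale0r addr0 /lin_gap !subrr dotp0r expr0n /= mulr0 subrr.
have Cfin : curvatureA D f \is a fin_num by rewrite ge0_fin_numE ?ltW.
have : ((2 / g ^+ 2 * lin_gap f x (x + g *: (s - x)))%:E <= curvatureA D f)%E.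
  by apply: ereal_sup_ubound; exists x, s, g.
rewrite -{1}(fineK Cfin) lee_fin.
have g20 : 0 < g ^+ 2 by rewrite exprn_even_gt0.
by rewrite mulrAC ler_pdivrMr //; lra.
Qed.

Lemma v_f_val_le x S v : proper_supports D x S ->
  argmax S (dotp (grad f x)) v -> v_f_val D f x <= dotp (grad f x) v.
Proof.
move=> pS aS; apply: ge_inf; last by exists S, v.
by exists (dotp (grad f x) x) => _ [S' [v' [pS' aS' ->]]];
  exact: proper_supports_max_ge pS' aS'.
Qed.

Lemma v_f_val_ge x S v : proper_supports D x S ->
  argmax S (dotp (grad f x)) v -> dotp (grad f x) x <= v_f_val D f x.
Proof.
move=> pS aS; apply: lb_le_inf; first by exists (dotp (grad f x) v), S, v.
by move=> _ [S' [v' [pS' aS' ->]]]; exact: proper_supports_max_ge pS' aS'.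
Qed.

(** Any Frank-Wolfe atom gives the value of the linear form at s_f; its
existence is what makes s_f a genuine minimizer. *)
Lemma dotp_s_f x s : argmin (extreme_points D) (dotp (grad f x)) s ->
  dotp (grad f x) (s_f D f x) = dotp (grad f x) s.
Proof.
move=> [es mins].
have : argmin (extreme_points D) (dotp (grad f x)) (s_f D f x).
  by apply: (@xgetPex _ 0); exists s.
by move=> [es' mins']; apply/eqP; rewrite eq_le mins // mins'.
Qed.

Hypothesis f_convex : convex_function [set: 'rV[R]_n] f.
Hypothesis f_diff : forall x, differentiable f x.

Lemma strong_convexityA_ge0 : (0 <= strong_convexityA D f)%E.
Proof.
apply: le_ereal_inf_tmp => _ [x Dx <-]; apply: le_ereal_inf_tmp => _ [z _ <-].
by rewrite lee_fin mulr_ge0 ?lin_gap_ge0 // divr_ge0 // sqr_ge0.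
Qed.

Lemma strong_convexityA_le x z : D x -> D z -> dotp (grad f x) (z - x) < 0 ->
  fine (strong_convexityA D f) <= 2 / gammaA D f x z ^+ 2 * lin_gap f x z.
Proof.
move=> Dx Dz xz.
have le : (strong_convexityA D f <=
           (2 / gammaA D f x z ^+ 2 * lin_gap f x z)%:E)%E.
  apply: le_trans (ereal_inf_lbound _) _; first by exists x => //; reflexivity.
  by apply: ereal_inf_lbound; exists z.
have mfin : strong_convexityA D f \is a fin_num.
  rewrite ge0_fin_numE ?strong_convexityA_ge0 //.
  exact: le_lt_trans le (ltry _).
by rewrite -lee_fin fineK.
Qed.

End constants.

(** * Representations of an iterate by weighted extreme points *)

Section representations.
Variables (R : realType) (n : nat) (D : set 'rV[R]_n).
Implicit Types (w : 'rV[R]_n -> R) (L : seq 'rV[R]_n) (a u v x : 'rV[R]_n).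

(** The set of points of positive weight is listed explicitly by L, so that its
cardinality is the size of L. *)
Definition represents w L x : Prop :=
  [/\ uniq L,
      forall v, v \in L -> extreme_points D v,
      forall v, 0 <= w v /\ (v \in L) = (0 < w v),
      \sum_(v <- L) w v = 1
    & \sum_(v <- L) w v *: v = x].

(** Both weight updates have this form: the Frank-Wolfe step of length c moves a
fraction c of the mass to the atom a, and the away step of length g is the case
c = - g. *)
Definition shift_weight w a (c : R) u : R := (1 - c) * w u + c * (u == a)%:R.

Definition add_atom a L := if a \in L then L else a :: L.

Lemma sum_shift_weight (W : lmodType R) (F : 'rV[R]_n -> W) w L a c :
  uniq L -> (a \notin L -> w a = 0) ->
  \sum_(u <- add_atom a L) shift_weight w a c u *: F u =
  (1 - c) *: (\sum_(u <- L) w u *: F u) + c *: F a.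
Proof.
move=> uL wa; under eq_bigr do rewrite scalerDl -2!scalerA.
rewrite big_split /= -2!scaler_sumr /add_atom; congr (_ *: _ + _ *: _).
  by case: ifPn => // /wa w0; rewrite big_cons w0 scale0r add0r.
have [uM aM] : uniq (add_atom a L) /\ a \in add_atom a L.
  by rewrite /add_atom; case: ifPn => //= aL; rewrite mem_head aL.
rewrite (bigD1_seq a) //= eqxx scale1r big1 ?addr0 // => u /negbTE ->.
by rewrite scale0r.
Qed.

Lemma represents_shift w L x a c : represents w L x -> extreme_points D a ->
  (forall u, 0 <= shift_weight w a c u) ->
  represents (shift_weight w a c)
    [seq u <- add_atom a L | 0 < shift_weight w a c u] ((1 - c) *: x + c *: a).
Proof.
move=> [uL eL w0 w1 wx] ea w'0; set w' := shift_weight w a c.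
have wa : a \notin L -> w a = 0.
  by case: (w0 a) => wa0 -> wapos; apply/eqP; rewrite eq_le wa0 leNgt wapos.
have sub (W : lmodType R) (F : 'rV[R]_n -> W) :
    \sum_(u <- [seq u <- add_atom a L | 0 < w' u]) w' u *: F u =
    \sum_(u <- add_atom a L) w' u *: F u.
  rewrite big_filter big_mkcond; apply: eq_bigr => u _.
  case: ltP => // w'le; suff -> : w' u = 0 by rewrite scale0r.
  by apply/eqP; rewrite eq_le w'le w'0.
have sum1 L' (h : 'rV[R]_n -> R) :
    \sum_(u <- L') h u = \sum_(u <- L') h u *: (1 : R^o).
  by apply: eq_bigr => u _; rewrite /GRing.scale /= mulr1.
split.
- by rewrite filter_uniq // /add_atom; case: ifPn => //= ->.
- move=> v; rewrite mem_filter /add_atom => /andP[_].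
  by case: ifPn => _; rewrite ?inE; [exact: eL|case/predU1P => [->//|/eL]].
- move=> v; split; first exact: w'0.
  rewrite mem_filter; case: ltP => //= w'v.
  have [->|va] := eqVneq v a.
    by rewrite /add_atom; case: ifPn => // _; rewrite mem_head.
  have : 0 < w v.
    move: w'v; rewrite /w' /shift_weight (negbTE va) mulr0 addr0 => w'v.
    case: (w0 v) => wv _; rewrite lt_neqAle wv andbT eq_sym.
    by apply: contraTneq w'v => ->; rewrite mulr0 ltxx.
  case: (w0 v) => _ <-; rewrite /add_atom.
  by case: ifPn => // _; rewrite inE orbC => ->.
- rewrite sum1 sub sum_shift_weight // -sum1 w1 /GRing.scale /=; ring.
- by rewrite sub sum_shift_weight // wx.
Qed.

Lemma represents_weight1 w L x a :
  represents w L x -> a \in L -> 1 <= w a -> x = a.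
Proof.
move=> [uL _ w0 w1 wx] aL wa; move: w1 wx; rewrite !(bigD1_seq a) //= => w1 <-.
have r0 : 0 <= \sum_(i <- L | i != a) w i.
  by apply: sumr_ge0 => i _; case: (w0 i).
have wa1 : w a = 1 by lra.
rewrite wa1 scale1r big_seq_cond big1 ?addr0 // => u /andP[uL' ua].
have /eqP : \sum_(i <- L | i != a) w i = 0 by lra.
rewrite psumr_eq0 => [/allP/(_ u uL')|i _]; last by case: (w0 i).
by rewrite ua => /eqP ->; rewrite scale0r.
Qed.

Lemma represents_nonempty w L x : represents w L x -> (0 < size L)%N.
Proof.
case: L => // -[_ _ _ + _]; rewrite big_nil => /esym/eqP.
by rewrite oner_eq0.
Qed.

Lemma represents_in w L x : convex_set D -> represents w L x -> D x.
Proof.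
move=> cD [_ eL w0 w1 <-]; apply: convex_set_sum => // v.
  by move=> /eL[].
by case: (w0 v).
Qed.

Lemma represents_support w L x : represents w L x ->
  proper_supports D x [set v | 0 < w v].
Proof.
move=> [uL eL w0 w1 <-].
have -> : [set v | 0 < w v] = [set` L].
  by apply/seteqP; split=> v /=; case: (w0 v) => _ ->.
by apply: proper_supports_seq => // v; case: (w0 v) => _ ->.
Qed.

End representations.

(** * The active set along a run, and the count of drop steps *)

Section run_representation.
Variables (R : realType) (n : nat) (D : set 'rV[R]_n).
Variables (f : 'rV[R]_n -> R) (tr : afw_trace R n).
Hypothesis tr_run : is_afw_run D f tr.

(** An away atom of weight 1 would be the iterate itself; the away direction
would then be 0, and a Frank-Wolfe step would have been chosen. *)
Lemma away_weight_lt1 k L : represents D (weight tr k) L (iterate tr k) ->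
  ~~ is_fw_step f tr k -> 0 < weight tr k (away_atom tr k) < 1.
Proof.
move=> rep; rewrite /is_fw_step /fw_dir /away_dir -ltNge => away.
have [act _] := afw_away_atom tr_run k; rewrite act /= ltNge.
apply/negP => wv.
have [_ eL w0 _ _] := rep.
have vL : away_atom tr k \in L by case: (w0 (away_atom tr k)) => _ ->.
have xv := represents_weight1 rep vL wv.
have [_ mins] := afw_fw_atom tr_run k.
have := mins _ (eL _ vL); rewrite -xv.
by move: away; rewrite -xv subrr dotp0r dotpBr subr_gt0 ltNge => /negP.
Qed.

Lemma next_weightE k v : weight tr k.+1 v =
  if is_fw_step f tr k
  then shift_weight (weight tr k) (fw_atom tr k) (stepsize tr k) v
  else shift_weight (weight tr k) (away_atom tr k) (- stepsize tr k) v.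
Proof.
rewrite (afw_weight tr_run) /next_weight /shift_weight.
by case: ifP => _; case: eqP => _; rewrite ?mulr1 ?mulr0 ?addr0 ?opprK.
Qed.

Lemma next_iterateE k : iterate tr k.+1 =
  if is_fw_step f tr k
  then (1 - stepsize tr k) *: iterate tr k + stepsize tr k *: fw_atom tr k
  else (1 - - stepsize tr k) *: iterate tr k
       + (- stepsize tr k) *: away_atom tr k.
Proof.
rewrite (afw_iterate tr_run) /step_dir /fw_dir /away_dir.
case: ifP => _; rewrite scalerBr scalerBl scale1r ?scaleNr ?opprK ?addrA //.
by rewrite addrAC.
Qed.

(** The maximal away step is exactly the one that brings the weight of the away
atom to 0. *)
Lemma next_weight_ge0 k L v : represents D (weight tr k) L (iterate tr k) ->
  0 <= weight tr k.+1 v.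
Proof.
move=> rep; rewrite next_weightE.
have /andP[g0] := afw_stepsize tr_run k; rewrite /gamma_max.
have [_ _ w0 _ _] := rep; have [wv _] := w0 v.
case: ifPn => [_ g1|away].
  by rewrite addr_ge0 // mulr_ge0 ?subr_ge0 ?ler0n.
have /andP[_ wlt1] := away_weight_lt1 rep away.
rewrite ler_pdivlMr ?subr_gt0 // /shift_weight => gmax.
case: eqP => [->|_] /=; last by rewrite mulr0 addr0 mulr_ge0 // opprK addr_ge0.
by rewrite mulr1; lra.
Qed.

Lemma represents_next k L : represents D (weight tr k) L (iterate tr k) ->
  exists2 L', represents D (weight tr k.+1) L' (iterate tr k.+1)
    & (size L' + is_drop_step f tr k <= size L + is_fw_step f tr k)%N.
Proof.
move=> rep; have w'0 v := next_weight_ge0 v rep.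
have [uL eL w0 _ _] := rep.
have := next_iterateE k; have := next_weightE k.
rewrite /is_drop_step /gamma_max.
case: ifPn => [fw|away] w' -> /=.
  have [es _] := afw_fw_atom tr_run k.
  move/funext: w' w'0 => -> w'0.
  exists [seq u <- add_atom (fw_atom tr k) L |
           0 < shift_weight (weight tr k) (fw_atom tr k) (stepsize tr k) u].
    exact: represents_shift.
  rewrite addn0 addn1 size_filter (leq_trans (count_size _ _)) //.
  by rewrite /add_atom; case: ifP.
have /andP[wpos wlt1] := away_weight_lt1 rep away.
set a := away_atom tr k in w' wpos wlt1 *.
have aL : a \in L by case: (w0 a) => _ ->.
move/funext: w' w'0 => -> w'0; set w' := shift_weight _ _ _ in w'0 *.
exists [seq u <- add_atom a L | 0 < w' u].
  by apply: represents_shift => //; exact: eL.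
rewrite /add_atom aL addn0 size_filter -(count_predC (fun u => 0 < w' u) L).
rewrite leq_add2l; case: eqP => // gmax; rewrite -has_count; apply/hasP.
exists a => //=; rewrite /w' /shift_weight eqxx gmax mulr1 -leNgt.
suff -> : (1 - - (weight tr k a / (1 - weight tr k a))) * weight tr k a
     + - (weight tr k a / (1 - weight tr k a)) = 0 by [].
by field; rewrite subr_eq0 gt_eqF.
Qed.

(** The size of the active set is a potential: each drop step consumes one unit
and only Frank-Wolfe steps produce units, one at most. *)
Lemma run_represents k : exists2 L, represents D (weight tr k) L (iterate tr k)
  & (size L + num_drops f tr k <= 1 + \sum_(i < k) is_fw_step f tr i)%N.
Proof.
elim: k => [|k [L rep le]].
  exists [:: iterate tr 0]; last by rewrite /num_drops !big_ord0.
  split=> //.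
  - by move=> v; rewrite inE => /eqP ->; exact: (afw_init tr_run).
  - move=> v; rewrite (afw_init_weight tr_run) inE ler0n ltr0n.
    by case: eqP.
  - by rewrite big_seq1 (afw_init_weight tr_run) eqxx.
  - by rewrite big_seq1 (afw_init_weight tr_run) eqxx scale1r.
have [L' rep' le'] := represents_next rep.
exists L' => //; move: le; rewrite /num_drops !big_ord_recr /=.
move: (\sum_(i < k) _)%N (\sum_(i < k) _)%N => d m; lia.
Qed.

Lemma num_drops_le_half k : (2 * num_drops f tr k <= k)%N.
Proof.
have [L rep le] := run_represents k.
have L0 := represents_nonempty rep.
have : (num_drops f tr k + \sum_(i < k) is_fw_step f tr i <= k)%N.
  rewrite -big_split /= -[leqRHS]card_ord -sum1_card leq_sum // => i _.
  by rewrite /is_drop_step; case: is_fw_step => //=; case: eqP.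
lia.
Qed.

End run_representation.

(** * Real inequalities behind the rate *)

Section scalar_estimates.
Variable R : realFieldType.
Implicit Types (C m g p h t : R).

(** The parabola - t p + C t^2 / 2 evaluated at t = min (1, g / 2C). At
t = g / 2C the decrease is at least g^2 / 8C, which m h <= g^2 / 2 turns into
(m / 4C) h. At t = 1 one has C <= p, so the decrease is at least p / 2, hence
at least h / 2, while m <= C makes m / 4C at most 1 / 4. *)
Lemma contraction_of_progress C m g p h h' t : 0 < C ->
  0 <= h -> h <= p -> 0 <= g -> g <= 2 * p -> m <= C -> m * h <= g ^+ 2 / 2 ->
  t = Num.min 1 (g / (2 * C)) -> h' <= h - t * p + C / 2 * t ^+ 2 ->
  h' <= (1 - m / (4 * C)) * h.
Proof.
move=> C0 h0 hp g0 gp mC mh tE h'le; apply: le_trans h'le _.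
have C4 : 0 < 4 * C by rewrite mulr_gt0.
have mE : m = m / (4 * C) * (4 * C) by rewrite mulfVK // gt_eqF.
set q := m / (4 * C) in mE *.
move: tE; case: (leP 1 (g / (2 * C))) => gC ->.
  move: gC; rewrite ler_pdivlMr ?mulr_gt0 // mul1r => gC.
  have q1 : q <= 1 / 4 by rewrite ler_pdivrMr //; lra.
  have : q * h <= 1 / 4 * h by rewrite ler_wpM2r.
  lra.
have gE : g = g / (2 * C) * (2 * C) by rewrite mulfVK // gt_eqF // mulr_gt0.
set t' := g / (2 * C) in gE *.
have qh : q * h <= C * t' ^+ 2 / 2.
  by rewrite -(ler_pM2l C4); move: mh; rewrite mE gE; nra.
have t0 : 0 <= t' by rewrite divr_ge0 // mulr_ge0 // ltW.
have : t' * (C * t') <= t' * p by rewrite ler_wpM2l //; lra.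
nra.
Qed.

Lemma descent_of_short_step C g p t : 0 < C -> 0 <= t -> g <= 2 * p ->
  t <= g / (2 * C) -> C / 2 * t ^+ 2 <= t * p.
Proof.
move=> C0 t0 gp; rewrite ler_pdivlMr ?mulr_gt0 // => tg; nra.
Qed.

(** With r = P / G the hypothesis reads h <= r G - m r^2 / 2, and the right-hand
side is at most its maximum over r, which is G^2 / 2m if m > 0. *)
Lemma suboptimality_le_gap_sq m P G g h : 0 <= m -> 0 < P -> P <= G -> G <= g ->
  0 < h -> m <= 2 / (P / G) ^+ 2 * (P - h) -> m * h <= g ^+ 2 / 2.
Proof.
move=> m0 P0 PG Gg h0.
have G0 : 0 < G by exact: lt_le_trans PG.
have -> : 2 / (P / G) ^+ 2 * (P - h) = 2 * G ^+ 2 * (P - h) / P ^+ 2.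
  by field; rewrite !gt_eqF.
rewrite ler_pdivlMr ?exprn_gt0 // => mP.
apply: (@le_trans _ _ (G ^+ 2 / 2)); last first.
  rewrite ler_pM2r ?invr_gt0 // ler_sqr ?nnegrE ?(ltW G0) //.
  by rewrite ltW // (lt_le_trans G0).
have P2 : 0 < P ^+ 2 by rewrite exprn_gt0.
rewrite -(ler_pM2r P2).
have : m * P ^+ 2 * h <= 2 * G ^+ 2 * (P - h) * h by rewrite ler_pM2r.
(* 4 (P - h) h <= P ^ 2 *)
have : 0 <= G ^+ 2 * (P - 2 * h) ^+ 2 by rewrite mulr_ge0 ?sqr_ge0.
nra.
Qed.

End scalar_estimates.

(** * Progress and suboptimality at one iteration *)

Section one_step.
Variables (R : realType) (n : nat) (D : set 'rV[R]_n).
Variables (f : 'rV[R]_n -> R) (xstar : 'rV[R]_n) (tr : afw_trace R n).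
Hypotheses (D_compact : compact D) (D_convex : convex_set D).
Hypothesis f_convex : convex_function [set: 'rV[R]_n] f.
Hypothesis f_diff : forall x, differentiable f x.
Hypothesis xstar_min : argmin D f xstar.
Hypotheses (C_gt0 : (0 < curvatureA D f)%E) (C_fin : (curvatureA D f < +oo)%E).
Hypothesis tr_run : is_afw_run D f tr.

Let x := iterate tr.
Let h k := f (x k) - f xstar.
Let C := fine (curvatureA D f).
Let mu := fine (strong_convexityA D f).
Let slope k := dotp (- grad f (x k)) (step_dir f tr k).

Lemma fine_curvatureA_gt0 : 0 < C.
Proof. by apply: fine_gt0; rewrite C_gt0. Qed.

Lemma iterate_in k : D (x k).
Proof.
by have [L rep _] := run_represents tr_run k; exact: represents_in rep.
Qed.

Lemma away_atom_in k : D (away_atom tr k).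
Proof.
have [L [_ eL w0 _ _] _] := run_represents tr_run k.
have [act _] := afw_away_atom tr_run k.
by have /eL[] : away_atom tr k \in L by case: (w0 (away_atom tr k)) => _ ->.
Qed.

Lemma fw_atom_in k : D (fw_atom tr k).
Proof. by case: (afw_fw_atom tr_run k) => -[]. Qed.

Lemma active_support k : proper_supports D (x k) (active_set tr k).
Proof.
by have [L rep _] := run_represents tr_run k; exact: represents_support rep.
Qed.

Lemma suboptimality_ge0 k : 0 <= h k.
Proof. by rewrite subr_ge0; apply: xstar_min.2; exact: iterate_in. Qed.

Lemma suboptimality_le_linear y : D y ->
  f y - f xstar <= - dotp (grad f y) (xstar - y).
Proof.
move=> Dy; have := lin_gap_ge0 xstar f_convex (f_diff y).
by rewrite /lin_gap; lra.
Qed.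

Lemma suboptimality_le_fw_gap y s : D y ->
  argmin (extreme_points D) (dotp (grad f y)) s ->
  f y - f xstar <= dotp (grad f y) y - dotp (grad f y) s.
Proof.
move=> Dy mins; have := suboptimality_le_linear Dy.
have := argmin_extreme_points D_compact mins xstar_min.1; rewrite dotpBr; lra.
Qed.

Lemma slope_max k :
  slope k = Num.max
    (dotp (grad f (x k)) (x k) - dotp (grad f (x k)) (fw_atom tr k))
    (dotp (grad f (x k)) (away_atom tr k) - dotp (grad f (x k)) (x k)).
Proof.
rewrite /slope /step_dir /is_fw_step dotpNl /fw_dir /away_dir /x.
by case: leP; rewrite !dotpBr => le; case: leP => le'; lra.
Qed.

Lemma afw_gapE k : afw_gap f tr k =
  dotp (grad f (x k)) (away_atom tr k) - dotp (grad f (x k)) (fw_atom tr k).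
Proof. by rewrite /afw_gap dotpNl dotpBr opprB. Qed.

Lemma gap_le_slope k : afw_gap f tr k <= 2 * slope k.
Proof.
rewrite slope_max afw_gapE.
set a := (X in Num.max X _); set b := (X in Num.max _ X).
have : a <= Num.max a b by rewrite le_max lexx.
have : b <= Num.max a b by rewrite le_max lexx orbT.
rewrite /a /b; lra.
Qed.

Lemma suboptimality_le_slope k : h k <= slope k.
Proof.
rewrite slope_max le_max; apply/orP; left.
exact: suboptimality_le_fw_gap (iterate_in k) (afw_fw_atom tr_run k).
Qed.

(** The away direction is a move of negative length towards the away atom,
which the two-sided curvature constant covers. *)
Lemma curvature_descent k (t : R) : 0 <= t <= 1 ->
  f (x k + t *: step_dir f tr k) <= f (x k) - t * slope k + C / 2 * t ^+ 2.
Proof.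
move=> /andP[t0 t1].
suff : lin_gap f (x k) (x k + t *: step_dir f tr k) <= C / 2 * t ^+ 2.
  rewrite /lin_gap [x k + _ - x k]addrAC subrr add0r dotpZr.
  by rewrite /slope dotpNl; lra.
rewrite /step_dir; case: ifP => _.
  apply: lin_gap_curvature => //; [exact: iterate_in|exact: fw_atom_in|].
  by rewrite t1 andbT; lra.
have -> : t *: away_dir tr k = (- t) *: (away_atom tr k - x k).
  by rewrite scaleNr -scalerN opprB.
rewrite -[t ^+ 2]sqrrN; apply: lin_gap_curvature => //.
- exact: iterate_in.
- exact: away_atom_in.
- by apply/andP; split; lra.
Qed.

Let gap_step k := Num.min 1 (afw_gap f tr k / (2 * C)).

Lemma afw_gap_ge0 k : 0 <= afw_gap f tr k.
Proof.
have := suboptimality_le_fw_gap (iterate_in k) (afw_fw_atom tr_run k).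
have := suboptimality_ge0 k.
have := proper_supports_max_ge (active_support k) (afw_away_atom tr_run k).
rewrite afw_gapE /h /x; lra.
Qed.

Lemma gap_step_itv k : 0 <= gap_step k <= 1.
Proof.
rewrite /gap_step ge_min lexx andbT le_min ler01 divr_ge0 ?afw_gap_ge0 //.
by rewrite mulr_ge0 // ltW // fine_curvatureA_gt0.
Qed.

Hypothesis tr_steps : line_search f tr \/ curvature_steps D f tr.

(** A prescribed step that is not a drop step cannot have been truncated at the
maximal away step. A line search that is not a drop step either runs over the
whole of [0, 1], or stops before the end of an away segment, and then
convex_ray_min lets it compete with steps beyond that segment. *)
Lemma non_drop_progress k : ~~ is_drop_step f tr k ->
  f (x k.+1) <= f (x k + gap_step k *: step_dir f tr k).
Proof.
move=> ndrop; have /andP[g0 g1] := gap_step_itv k.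
rewrite /x (afw_iterate tr_run); case: tr_steps => [ls|cs].
  have [/andP[s0 smax] mins] := ls k.
  move: ndrop; rewrite /is_drop_step negb_and negbK => /orP[fw|ns].
    by apply: mins; rewrite /= /gamma_max fw g0.
  apply: (convex_ray_min f_convex _ g0 mins).
  by rewrite s0 lt_neqAle ns.
rewrite (_ : stepsize tr k = gap_step k) //.
move: ndrop; rewrite /is_drop_step negb_and negbK (cs k) => /orP[fw|].
  by rewrite /gamma_max fw minA minxx.
case: (leP (gamma_max f tr k) (gammaB D f tr k)) => // le.
case: leP => // le1.
  by rewrite /gap_step => _; apply/esym/min_idPl/(le_trans le1).
by rewrite eqxx.
Qed.

(** Drop steps included: truncating the step keeps it on the decreasing part of
the bounding parabola. *)
Lemma suboptimality_nonincreasing k : h k.+1 <= h k.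
Proof.
rewrite lerD2r /x (afw_iterate tr_run).
have /andP[s0 smax] := afw_stepsize tr_run k.
case: tr_steps => [ls|cs].
  have [_ mins] := ls k.
  have := mins 0; rewrite /= lexx scale0r addr0; apply.
  exact: le_trans smax.
have s1 : stepsize tr k <= 1 by rewrite (cs k) ge_min lexx.
have sB : stepsize tr k <= afw_gap f tr k / (2 * C).
  by rewrite (cs k) !ge_min lexx !orbT.
apply: le_trans (curvature_descent k _) _; first by rewrite s0.
have := descent_of_short_step fine_curvatureA_gt0 s0 (gap_le_slope k) sB.
by rewrite /x; lra.
Qed.

Lemma suboptimality_le_init k : h k <= h 0%N.
Proof. by elim: k => // k; exact: le_trans (suboptimality_nonincreasing k). Qed.

Lemma v_f_gap_le k : v_f_val D f (x k) - dotp (grad f (x k)) (s_f D f (x k))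
  <= afw_gap f tr k.
Proof.
rewrite afw_gapE (dotp_s_f (afw_fw_atom tr_run k)) lerD2r.
exact: v_f_val_le (active_support k) (afw_away_atom tr_run k).
Qed.

(** The infimum that defines mu is used at the single pair (iterate, xstar). *)
Lemma mu_suboptimality_le k : mu * h k <= afw_gap f tr k ^+ 2 / 2.
Proof.
have [h0|] := ltP 0 (h k); last first.
  move=> hle; have -> : h k = 0.
    by apply/eqP; rewrite eq_le hle suboptimality_ge0.
  by rewrite mulr0 divr_ge0 ?sqr_ge0.
have lin := suboptimality_le_linear (iterate_in k).
have mu0 : 0 <= mu by apply/fine_ge0/strong_convexityA_ge0.
set P := - dotp (grad f (x k)) (xstar - x k) in lin.
set G := v_f_val D f (x k) - dotp (grad f (x k)) (s_f D f (x k)).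
have P0 : 0 < P by exact: lt_le_trans lin.
have PG : P <= G.
  have := v_f_val_ge (active_support k) (afw_away_atom tr_run k).
  have := argmin_extreme_points D_compact (afw_fw_atom tr_run k) xstar_min.1.
  by rewrite /P /G (dotp_s_f (afw_fw_atom tr_run k)) dotpBr /x; lra.
apply: (suboptimality_le_gap_sq mu0 P0 PG (v_f_gap_le k) h0).
have := strong_convexityA_le f_convex f_diff (iterate_in k) xstar_min.1.
rewrite -oppr_gt0 => /(_ P0).
have -> : gammaA D f (iterate tr k) xstar = P / G.
  by rewrite /gammaA -/(x k) /P /G -[in RHS](opprB (dotp _ _)) invrN mulrNN.
have -> // : lin_gap f (iterate tr k) xstar = P - h k.
by rewrite /lin_gap /P /h -/(x k); lra.
Qed.

(** At the starting vertex y the only relevant support is [set y], since its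
value meets the lower bound <grad f y, y>; thus gammaA D f y s = 1 and the pair
(y, s) bounds mu from above by a member of the set whose supremum is C. The
hypothesis makes y a non-minimizer, so that this pair is admissible for mu. *)
Lemma mu_le_curvature : 0 < h 0%N -> mu <= C.
Proof.
move=> h0; have ex := afw_init tr_run; have mins := afw_fw_atom tr_run 0.
set y := iterate tr 0 in ex mins *; set s := fw_atom tr 0 in mins.
have ly := suboptimality_le_fw_gap (iterate_in 0) mins.
have ys : dotp (grad f y) (s - y) < 0.
  by rewrite dotpBr; move: h0 ly; rewrite /h /x -/y; lra.
have single : proper_supports D y [set` [:: y]].
  have := @proper_supports_seq _ _ D [:: y] (fun=> 1) isT.
  rewrite !big_seq1 scale1r; apply=> // v; rewrite inE => /eqP -> //.
have maxy : argmax [set` [:: y]] (dotp (grad f y)) y.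
  by split; rewrite /= ?mem_head // => u; rewrite inE => /eqP ->.
have vy : v_f_val D f y = dotp (grad f y) y.
  by apply/eqP; rewrite eq_le (v_f_val_le single maxy) (v_f_val_ge single maxy).
have g1 : gammaA D f y s = 1.
  by rewrite /gammaA vy (dotp_s_f mins) dotpBr divff // -dotpBr lt_eqF.
have lower :=
  strong_convexityA_le f_convex f_diff (iterate_in 0) (fw_atom_in 0) ys.
have m11 : -1 <= (1 : R) <= 1 by apply/andP; split; lra.
have upper := lin_gap_curvature C_gt0 C_fin (iterate_in 0) (fw_atom_in 0) m11.
move: lower upper; rewrite g1 expr1n divr1 mulr1 scale1r [x 0%N + _]addrC subrK.
by rewrite /C /mu /x -/y -/s; lra.
Qed.

Lemma non_drop_contraction k : ~~ is_drop_step f tr k ->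
  h k.+1 <= (1 - rhoA D f) * h k.
Proof.
move=> ndrop; have [h0|h0] := ltP 0 (h 0%N); last first.
  have hz j : h j = 0.
    apply/eqP; rewrite eq_le suboptimality_ge0.
    by rewrite (le_trans (suboptimality_le_init j)).
  by rewrite !hz mulr0.
apply: (contraction_of_progress fine_curvatureA_gt0 (suboptimality_ge0 k)
  (suboptimality_le_slope k) (afw_gap_ge0 k) (gap_le_slope k)
  (mu_le_curvature h0) (mu_suboptimality_le k) (erefl (gap_step k))).
have := non_drop_progress ndrop; have := curvature_descent k (gap_step_itv k).
by rewrite /h; lra.
Qed.

Lemma rhoA_ge0 : 0 <= rhoA D f.
Proof.
rewrite divr_ge0 ?mulr_ge0 ?(ltW fine_curvatureA_gt0) //.
exact/fine_ge0/strong_convexityA_ge0.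
Qed.

Lemma suboptimality_exp_decay k :
  h k <= h 0%N * expR (- rhoA D f * (k%:R - (num_drops f tr k)%:R)).
Proof.
elim: k => [|k IH].
  by rewrite /num_drops big_ord0 subrr mulr0 expR0 mulr1.
rewrite /num_drops big_ord_recr /= -/(num_drops f tr k).
case: (boolP (is_drop_step f tr k)) => [drop|ndrop] /=.
  apply: le_trans (suboptimality_nonincreasing k) _.
  by rewrite addn1 -!natr1 opprD addrACA subrr addr0.
apply: le_trans (non_drop_contraction ndrop) _.
have rho1 := expR_ge1Dx (- rhoA D f).
apply: le_trans (ler_wpM2r (suboptimality_ge0 k) rho1) _.
rewrite addn0 -natr1; set r := - rhoA D f; set d := num_drops f tr k.
have -> : r * (k%:R + 1 - d%:R) = r * (k%:R - d%:R) + r by ring.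
rewrite expRD mulrA [leRHS]mulrC.
by rewrite ler_pM2l ?expR_gt0.
Qed.

End one_step.

(** * Linear convergence *)

Theorem theorem7 (R : realType) (n : nat) (D : set 'rV[R]_n)
    (f : 'rV[R]_n -> R) (xstar : 'rV[R]_n) (tr : afw_trace R n)
    (D_compact : compact D)
    (D_convex : convex_set D)
    (f_convex : convex_function [set: 'rV[R]_n] f)
    (f_diff : forall x : 'rV[R]_n, differentiable f x)
    (f_nonconst : ~ exists c : R, forall x : 'rV[R]_n, D x -> f x = c)
    (xstar_min : argmin D f xstar)
    (C_gt0 : (0 < curvatureA D f)%E)
    (C_fin : (curvatureA D f < +oo)%E)
    (tr_run : is_afw_run D f tr)
    (tr_steps : line_search f tr \/ curvature_steps D f tr) :
  let h := fun k : nat => f (iterate tr k) - f xstar in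
  [/\ forall k : nat, ~~ is_drop_step f tr k -> h k.+1 <= (1 - rhoA D f) * h k,
      forall k : nat, (num_drops f tr k)%:R <= k%:R / 2 :> R
    & forall k : nat, h k <= h 0%N * expR (- (1 / 2) * rhoA D f * k%:R)].
Proof.
move=> h.
have drops k : (num_drops f tr k)%:R <= k%:R / 2 :> R.
  by rewrite ler_pdivlMr // -natrM ler_nat mulnC (num_drops_le_half tr_run).
split=> // k.
  exact: (non_drop_contraction (xstar := xstar)).
have decay := suboptimality_exp_decay D_compact D_convex f_convex f_diff
  xstar_min C_gt0 C_fin tr_run tr_steps k.
apply: le_trans decay _.
rewrite ler_wpM2l // ?ler_expR.
  exact: (suboptimality_ge0 _ xstar_min tr_run).
have := drops k; have := rhoA_ge0 f_convex f_diff C_gt0 C_fin; nra.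
Qed.
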